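(* Let $k$ be a field, let $A$ be a unital associative $k$-algebra, let $(\partial,\sigma;\bar\sigma,\hat\sigma)$ be a free right twisted multi-derivation on $A$, and let $(\Omega^1(A),d)$ be the associated first order differential calculus with generators $\omega_1,\dots,\omega_n$. Define right $A$-module maps $\xi_i:\Omega^1(A)\to A$ by $\xi_i(\omega_j)=\delta_{ij}$, $i,j=1,\dots,n$. Then there exists a unique hom-connection $\nabla:\mathrm{Hom}_A(\Omega^1(A),A)\to A$ such that $\nabla(\xi_i)=0$ for all $i=1,\dots,n$.
   Context: A right twisted multi-derivation in $A$ is a pair $(\partial,\sigma)$, where $\sigma:A\to M_n(A)$, $\sigma(a)=(\sigma_{ij}(a))_{i,j=1}^n$, is an algebra homomorphism and $\partial:A\to A^n$, $\partial(a)=(\partial_i(a))_{i=1}^n$, is a $k$-linear map such that $\partial_i(ab)=\sum_j\partial_j(a)\sigma_{ji}(b)+a\partial_i(b)$ for all $a,b\in A$ and all $i$. Viewing maps $A\to M_n(A)$ as elements of $M_n(\mathrm{End}_k(A))$ with product $(\alpha\bullet\beta)_{ij}=\sum_k\alpha_{ik}\circ\beta_{kj}$, unit $\mathbb{I}$ and transpose $(\alpha^T)_{ij}=\alpha_{ji}$, the pair $(\partial,\sigma)$ is free if there exist algebra maps $\bar\sigma,\hat\sigma:A\to M_n(A)$ such that $\bar\sigma\bullet\sigma^T=\mathbb{I}=\sigma^T\bullet\bar\sigma$ and $\hat\sigma\bullet\bar\sigma^T=\mathbb{I}=\bar\sigma^T\bullet\hat\sigma$; one then writes $(\partial,\sigma;\bar\sigma,\hat\sigma)$.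 The associated first order differential calculus: $\Omega^1(A)$ is the free left $A$-module with basis $\omega_1,\dots,\omega_n$, with right $A$-action determined by $\omega_ia=\sum_j\sigma_{ij}(a)\omega_j$, and $d:A\to\Omega^1(A)$ is $da=\sum_i\partial_i(a)\omega_i$ (a derivation). One has $a\omega_i=\sum_j\omega_j\bar\sigma_{ji}(a)$, and $\omega_1,\dots,\omega_n$ is also a basis of $\Omega^1(A)$ as a right $A$-module. A hom-connection on $A$ with respect to $(\Omega^1(A),d)$ is a $k$-linear map $\nabla:\mathrm{Hom}_A(\Omega^1(A),A)\to A$ ($\mathrm{Hom}_A$ = right $A$-module maps) such that $\nabla(fa)=\nabla(f)a+f(da)$ for all $f\in\mathrm{Hom}_A(\Omega^1(A),A)$, $a\in A$, where $(fa)(\omega)=f(a\omega)$. *)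

(* Defs.v *)
From HB Require Import structures.
From mathcomp Require Import all_boot all_order all_algebra.
From mathcomp Require Import boolp.

Set Implicit Arguments.
Unset Strict Implicit.
Unset Printing Implicit Defensive.

Import GRing.Theory.
Local Open Scope ring_scope.

Section TwistedMultiDerivations.
Variables (k : fieldType) (A : algType k) (n : nat).
Implicit Types (s sb sh : A -> 'M[A]_n) (dd : A -> 'rV[A]_n).

(* k acts on matrices and vectors over A entrywise; the library only equips
   'M[A]_n with its A-module structure, hence the map_mx below. *)
Definition mx_alg_hom s :=
  [/\ forall (c : k) (a b : A), s (c *: a + b) = map_mx ( *:%R c) (s a) + s b,
      forall a b : A, s (a * b) = s a *m s b
    & s 1 = 1%:M].

Definition right_twisted_multider dd s :=
  [/\ mx_alg_hom s,
      forall (c : k) (a b : A), dd (c *: a + b) = map_mx ( *:%R c) (dd a) + dd b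
    & forall (a b : A) (i : 'I_n),
        dd (a * b) 0 i = \sum_(j < n) dd a 0 j * s b j i + a * dd b 0 i].

(* A map A -> 'M[A]_n is viewed as the matrix of maps (fun a => s a i j), and
   matrices of maps are multiplied using composition of entries. *)
Definition bullet s1 s2 : A -> 'M[A]_n :=
  fun a => \matrix_(i, j) \sum_(l < n) s1 (s2 a l j) i l.

Definition bullet_unit : A -> 'M[A]_n := fun a => a%:M.

Definition bullet_tr s : A -> 'M[A]_n := fun a => (s a)^T.

Definition free_right_twisted_multider dd s sb sh :=
  [/\ right_twisted_multider dd s, mx_alg_hom sb, mx_alg_hom sh,
      bullet sb (bullet_tr s) =1 bullet_unit
        /\ bullet (bullet_tr s) sb =1 bullet_unit
    & bullet sh (bullet_tr sb) =1 bullet_unit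
        /\ bullet (bullet_tr sb) sh =1 bullet_unit].

(* Omega^1(A) is the free left A-module 'rV[A]_n: the row v stands for
   \sum_i v_i omega_i. The right action omega_i a = \sum_j s_ij(a) omega_j
   thus sends v to v *m s a, and d a = \sum_i dd_i(a) omega_i is the row dd a. *)
Definition omega (i : 'I_n) : 'rV[A]_n := delta_mx 0 i.

Definition omega_ract s (v : 'rV[A]_n) (a : A) : 'rV[A]_n := v *m s a.

Lemma omega_ractE s i a :
  omega_ract s (omega i) a = \sum_(j < n) s a i j *: omega j.
Proof.
rewrite /omega_ract -rowE [LHS]row_sum_delta.
by apply: eq_bigr => j _; rewrite mxE.
Qed.

(* Hom_A(Omega^1(A), A): the right A-module maps. *)
Record rhom s := RHom {
  rhom_fun :> 'rV[A]_n -> A;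
  rhomD : {morph rhom_fun : u v / u + v};
  rhomM : forall v a, rhom_fun (omega_ract s v a) = rhom_fun v * a }.

Lemma rhomP s (f g : rhom s) : f =1 g -> f = g.
Proof.
case: f g => [f fD fM] [g gD gM] /= /funext fg; subst g.
by congr RHom; apply: Prop_irrelevance.
Qed.

HB.instance Definition _ s := gen_eqMixin (rhom s).
HB.instance Definition _ s := gen_choiceMixin (rhom s).

Section RightHom.
Variable s : A -> 'M[A]_n.
Implicit Types f g : rhom s.

Definition rhom_zero : rhom s.
Proof.
by apply: (@RHom s (fun=> 0)) => [u v | v a]; rewrite ?addr0 ?mul0r.
Defined.

Definition rhom_opp f : rhom s.
Proof.
by apply: (@RHom s (fun v => - f v)) => [u v | v a];
  rewrite ?rhomD ?rhomM ?opprD ?mulNr.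
Defined.

Definition rhom_add f g : rhom s.
Proof.
by apply: (@RHom s (fun v => f v + g v)) => [u v | v a];
  rewrite ?rhomD ?rhomM ?mulrDl // addrACA.
Defined.

Definition rhom_scale (c : k) f : rhom s.
Proof.
by apply: (@RHom s (fun v => c *: f v)) => [u v | v a];
  rewrite ?rhomD ?rhomM ?scalerDr ?scalerAl.
Defined.

(* (f a)(w) = f (a w) *)
Definition rhom_ract f (a : A) : rhom s.
Proof.
by apply: (@RHom s (fun v => f (a *: v))) => [u v | v b];
  rewrite ?scalerDr ?rhomD // -rhomM /omega_ract scalemxAl.
Defined.

Fact rhom_addA : associative rhom_add.
Proof. by move=> f g h; apply: rhomP => v /=; rewrite addrA. Qed.
Fact rhom_addC : commutative rhom_add.
Proof. by move=> f g; apply: rhomP => v /=; rewrite addrC. Qed.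
Fact rhom_add0 : left_id rhom_zero rhom_add.
Proof. by move=> f; apply: rhomP => v /=; rewrite add0r. Qed.
Fact rhom_addN : left_inverse rhom_zero rhom_opp rhom_add.
Proof. by move=> f; apply: rhomP => v /=; rewrite addNr. Qed.

HB.instance Definition _ :=
  GRing.isZmodule.Build (rhom s) rhom_addA rhom_addC rhom_add0 rhom_addN.

Fact rhom_scaleA c e f : rhom_scale c (rhom_scale e f) = rhom_scale (c * e) f.
Proof. by apply: rhomP => v /=; rewrite scalerA. Qed.
Fact rhom_scale1 : left_id 1 rhom_scale.
Proof. by move=> f; apply: rhomP => v /=; rewrite scale1r. Qed.
Fact rhom_scaleDr : right_distributive rhom_scale +%R.
Proof. by move=> c f g; apply: rhomP => v /=; rewrite scalerDr. Qed.
Fact rhom_scaleDl f : {morph rhom_scale^~ f : c e / c + e}.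
Proof. by move=> c e; apply: rhomP => v /=; rewrite scalerDl. Qed.

HB.instance Definition _ := GRing.Zmodule_isLmodule.Build k (rhom s)
  rhom_scaleA rhom_scale1 rhom_scaleDr rhom_scaleDl.

End RightHom.

Definition hom_connection dd s (nabla : rhom s -> A) :=
  linear nabla
  /\ forall (f : rhom s) (a : A), nabla (rhom_ract f a) = nabla f * a + f (dd a).

(* Since the omega_i also form a basis of Omega^1(A) as a right A-module,
   xi_i(omega_j) = delta_ij determines the right A-module maps xi_i. *)
Lemma dual_family_exists_unique dd s sb sh :
  free_right_twisted_multider dd s sb sh ->
  exists! xi : 'I_n -> rhom s,
    forall i j : 'I_n, xi i (omega j) = (i == j)%:R.
Proof.
move=> [_ [sbL sbM sb1] _ [sbs ssb] _].
have sbD a b : sb (a + b) = sb a + sb b.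
  rewrite -[a in LHS]scale1r sbL; congr (_ + _).
  by apply/matrixP => i j; rewrite mxE scale1r.
have sb0 : sb 0 = 0 by apply: (addrI (sb 0)); rewrite -sbD !addr0.
have sb_sum (I : finType) (F : I -> A) i j :
    sb (\sum_x F x) i j = \sum_x sb (F x) i j.
  apply: (big_morph (fun a => sb a i j)) => [a b|]; first by rewrite sbD mxE.
  by rewrite sb0 mxE.
have rD (i : 'I_n) :
    {morph (fun v : 'rV[A]_n => \sum_j sb (v 0 j) i j) : u v / u + v}.
  move=> u v; rewrite -big_split; apply: eq_bigr => j _ /=.
  by rewrite mxE sbD mxE.
have rM (i : 'I_n) (v : 'rV[A]_n) a :
    \sum_j sb (omega_ract s v a 0 j) i j = (\sum_j sb (v 0 j) i j) * a.
  have E (j : 'I_n) : sb (omega_ract s v a 0 j) i j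
      = \sum_l \sum_m sb (v 0 l) i m * sb (s a l j) m j.
    rewrite mxE sb_sum; apply: eq_bigr => l _.
    by rewrite sbM mxE.
  rewrite (eq_bigr _ (fun j _ => E j)) exchange_big /= mulr_suml.
  apply: eq_bigr => l _; rewrite exchange_big /=.
  have F (m : 'I_n) : \sum_j sb (v 0 l) i m * sb (s a l j) m j
      = sb (v 0 l) i m * (a *+ (m == l)).
    rewrite -mulr_sumr; congr (_ * _).
    have /matrixP /(_ m l) := sbs a; rewrite !mxE => <-.
    by apply: eq_bigr => j _; rewrite mxE.
  rewrite (eq_bigr _ (fun m _ => F m)) (bigD1 l) //= eqxx mulr1n.
  by rewrite big1 ?addr0 // => m /negPf ->; rewrite mulr0n mulr0.
exists (fun i => RHom (rD i) (rM i)); split.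
  move=> i j /=; rewrite (bigD1 j) //= !mxE !eqxx sb1 mxE.
  by rewrite big1 ?addr0 // => l /negPf nlj; rewrite !mxE nlj andbF sb0 mxE.
move=> xi xiP; apply: funext => i; apply: rhomP => v /=.
have f0 : xi i 0 = 0 by apply: (addrI (xi i 0)); rewrite -rhomD !addr0.
have fsum (F : 'I_n -> 'rV[A]_n) : xi i (\sum_x F x) = \sum_x xi i (F x).
  by apply: (big_morph (xi i)); [exact: rhomD | exact: f0].
have fZ (a : A) (j : 'I_n) : xi i (a *: omega j) = sb a i j.
  have -> : a *: omega j = \sum_l omega_ract s (omega l) (sb a l j).
    apply/rowP => m; rewrite summxE.
    have /matrixP /(_ m j) := ssb a; rewrite !mxE => E.
    rewrite eqxx /= mulr_natr -E; apply: eq_bigr => l _.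
    by rewrite /omega_ract -rowE !mxE.
  rewrite fsum (bigD1 i) //= rhomM xiP eqxx mul1r.
  rewrite big1 ?addr0 // => l; rewrite rhomM xiP eq_sym => /negPf ->.
  by rewrite mul0r.
rewrite [in RHS](row_sum_delta v) fsum.
by apply: eq_bigr => j _; rewrite fZ.
Qed.

End TwistedMultiDerivations.

(* Main.v *)
Require Import Defs.
From HB Require Import structures.
From mathcomp Require Import all_boot all_order all_algebra.
From mathcomp Require Import boolp.

Set Implicit Arguments.
Unset Strict Implicit.
Unset Printing Implicit Defensive.

Import GRing.Theory.
Local Open Scope ring_scope.

(** The theorem holds because the functionals [xi i] form a basis of
    Hom_A(Omega^1(A), A) as a right A-module. The inverse pair
    [sigma^T], [sigma_bar] makes the [omega j] a right basis of Omega^1(A), so a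
    right A-linear [f] is determined by the values [f (omega j)], and the value
    of [sum_i xi_i a_i] at [omega j] is [sum_i sigma_bar_ij(a_i)]. Solving
    [f (omega j) = sum_i sigma_bar_ij(a_i)] for the [a_i] is what the second
    inverse pair [sigma_bar^T], [sigma_hat] allows: the unique solution is
    [a_i = sum_j sigma_hat_ij (f (omega j))], called [dual_coef] below
    ([dual_coef_expansion]).

    A hom-connection killing every [xi i] must then send
    [f = sum_i xi_i a_i] to [sum_i xi_i(d a_i)], whence uniqueness. Conversely
    this formula defines a hom-connection: the coordinates are right A-linear
    ([dual_coef_ract]), so [d (a_i b) = d(a_i) b + a_i d(b)] yields the Leibniz
    rule, the second term summing to [sum_i (xi_i a_i)(d b) = f (d b)]. It kills
    each [xi i] because the coordinates of [xi i] are 0 or 1 and [d 1 = 0]. *)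

Section HomConnections.
Variables (k : fieldType) (A : algType k) (n : nat).
Implicit Types (s sb sh : A -> 'M[A]_n) (dd : A -> 'rV[A]_n).

Lemma map_scale1r m (M : 'M[A]_(m, n)) : map_mx ( *:%R (1 : k)) M = M.
Proof. by apply/matrixP => i j; rewrite mxE scale1r. Qed.

Lemma mx_alg_hom_additive s : mx_alg_hom s -> {morph s : a b / a + b}.
Proof. by case=> sL _ _ a b; rewrite -[a in LHS]scale1r sL map_scale1r. Qed.

Lemma mx_alg_hom0 s : mx_alg_hom s -> s 0 = 0.
Proof.
by move=> /mx_alg_hom_additive sD; apply: (addrI (s 0)); rewrite -sD !addr0.
Qed.

Lemma mx_alg_hom_sum s (I : finType) (F : I -> A) i j :
  mx_alg_hom s -> s (\sum_x F x) i j = \sum_x s (F x) i j.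
Proof.
move=> hs; apply: (big_morph (fun a => s a i j)) => [a b|].
  by rewrite mx_alg_hom_additive // mxE.
by rewrite mx_alg_hom0 // mxE.
Qed.

Lemma mx_alg_hom_scalar s (c : k) : mx_alg_hom s -> s c%:A = (c%:A)%:M.
Proof.
move=> hs; have [sL _ s1] := hs.
rewrite -[c%:A]addr0 sL mx_alg_hom0 // addr0 s1.
by apply/matrixP => i j; rewrite !mxE addr0 scalerMnr.
Qed.

Lemma rhom0 s (f : rhom s) : f 0 = 0.
Proof. by apply: (addrI (f 0)); rewrite -rhomD !addr0. Qed.

Lemma rhom_sum s (f : rhom s) (I : finType) (F : I -> 'rV[A]_n) :
  f (\sum_x F x) = \sum_x f (F x).
Proof. by apply: (big_morph f); [exact: rhomD | exact: rhom0]. Qed.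

(** Scalars of [k] are central in [A] and [s] fixes them, so scaling by them
    is an instance of the right action. *)
Lemma rhom_scalar s (f : rhom s) (c : k) v :
  mx_alg_hom s -> f (map_mx ( *:%R c) v) = c *: f v.
Proof.
move=> hs; rewrite -[in RHS]mulr_algr -rhomM /omega_ract mx_alg_hom_scalar //.
congr (f _); apply/rowP => j; rewrite !mxE (bigD1 j) //= mxE eqxx mulr1n.
rewrite mulr_algr big1 ?addr0 // => l /negPf lj.
by rewrite mxE lj mulr0n mulr0.
Qed.

Lemma rhom_sumE s (I : finType) (F : I -> rhom s) v :
  (\sum_x F x) v = \sum_x F x v.
Proof. by apply: (big_morph (fun f : rhom s => f v)). Qed.

Lemma multider1 dd s : right_twisted_multider dd s -> dd 1 = 0.
Proof.
move=> [[_ _ s1] _ ddM]; apply/rowP => i; rewrite mxE.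
have /eqP := ddM 1 1 i; rewrite !mul1r s1 (bigD1 i) //= mxE eqxx mulr1.
rewrite big1 => [|j /negPf ji]; last by rewrite mxE ji mulr0.
by rewrite addr0 -subr_eq subrr eq_sym => /eqP.
Qed.

Lemma multider0 dd s : right_twisted_multider dd s -> dd 0 = 0.
Proof.
move=> [_ ddL _]; have := ddL 1 0 0.
rewrite scale1r addr0 map_scale1r => /eqP.
by rewrite -subr_eq subrr eq_sym => /eqP.
Qed.

Lemma multider_leibniz dd s a b : right_twisted_multider dd s ->
  dd (a * b) = omega_ract s (dd a) b + a *: dd b.
Proof. by move=> [_ _ ddM]; apply/rowP => i; rewrite ddM !mxE. Qed.

(** The coefficient of [omega m] on the right is [sum_j s_jm(sb_ji(a))], which
    is entry [(m, i)] of the product of [s^T] and [sb]. Hence a one-sided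
    inverse suffices for the [omega j] to generate Omega^1(A) from the right. *)
Lemma scale_omega s sb a i : bullet (bullet_tr s) sb =1 @bullet_unit _ _ _ ->
  a *: omega A i = \sum_j omega_ract s (omega A j) (sb a j i).
Proof.
move=> ssb; apply/rowP => m; rewrite summxE.
have /matrixP /(_ m i) := ssb a; rewrite !mxE eqxx /= mulr_natr => <-.
by apply: eq_bigr => l _; rewrite /omega_ract -rowE !mxE.
Qed.

Lemma rhom_scale_omega s sb (f : rhom s) a i :
  bullet (bullet_tr s) sb =1 @bullet_unit _ _ _ ->
  f (a *: omega A i) = \sum_j f (omega A j) * sb a j i.
Proof.
move=> ssb; rewrite (scale_omega _ _ ssb) rhom_sum.
by apply: eq_bigr => j _; rewrite rhomM.
Qed.

Lemma rhom_eq_omega s (f g : rhom s) sb :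
  bullet (bullet_tr s) sb =1 @bullet_unit _ _ _ ->
  (forall j, f (omega A j) = g (omega A j)) -> f = g.
Proof.
move=> ssb fg; apply: rhomP => v; rewrite (row_sum_delta v) !rhom_sum.
apply: eq_bigr => j _; rewrite !(rhom_scale_omega _ _ _ ssb).
by apply: eq_bigr => l _; rewrite fg.
Qed.

Definition dual_coef s sh (f : rhom s) i : A := \sum_j sh (f (omega A j)) i j.

Lemma dual_coef_linear s sh i : mx_alg_hom sh ->
  linear (fun f : rhom s => dual_coef sh f i).
Proof.
move=> [shL _ _] c f g; rewrite /dual_coef scaler_sumr -big_split.
by apply: eq_bigr => j _; rewrite /= shL !mxE.
Qed.

(** Applying [sh], which is multiplicative, to
    [(f a)(omega j) = sum_l f(omega_l) sb_lj(a)] leaves the sums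
    [sum_j sh_mj(sb_lj(a))], which collapse since [sh] is a left inverse of
    [sb^T]. *)
Lemma dual_coef_ract s sb sh (f : rhom s) a i :
  mx_alg_hom sh ->
  bullet (bullet_tr s) sb =1 @bullet_unit _ _ _ ->
  bullet sh (bullet_tr sb) =1 @bullet_unit _ _ _ ->
  dual_coef sh (rhom_ract f a) i = dual_coef sh f i * a.
Proof.
move=> hsh ssb shsb; have [_ shM _] := hsh.
transitivity (\sum_j \sum_l \sum_m sh (f (omega A l)) i m * sh (sb a l j) m j).
  apply: eq_bigr => j _; rewrite /= (rhom_scale_omega _ _ _ ssb).
  by rewrite mx_alg_hom_sum //; apply: eq_bigr => l _; rewrite shM mxE.
rewrite exchange_big /= mulr_suml; apply: eq_bigr => l _.
rewrite exchange_big /=.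
have collapse m : \sum_j sh (f (omega A l)) i m * sh (sb a l j) m j
    = sh (f (omega A l)) i m * (a *+ (m == l)).
  rewrite -mulr_sumr; congr (_ * _).
  have /matrixP /(_ m l) := shsb a; rewrite !mxE => <-.
  by apply: eq_bigr => j _; rewrite mxE.
rewrite (eq_bigr _ (fun m _ => collapse m)) (bigD1 l) //= eqxx mulr1n.
by rewrite big1 ?addr0 // => m /negPf ->; rewrite mulr0n mulr0.
Qed.

Section DualFamily.
Variables (s sb sh : A -> 'M[A]_n) (xi : 'I_n -> rhom s).
Hypothesis xiP : forall i j : 'I_n, xi i (omega A j) = (i == j)%:R.
Hypothesis ssb : bullet (bullet_tr s) sb =1 @bullet_unit _ _ _.

Lemma dual_scale_omega i a j : xi i (a *: omega A j) = sb a i j.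
Proof.
rewrite (rhom_scale_omega _ _ _ ssb) (bigD1 i) //= xiP eqxx mul1r.
by rewrite big1 ?addr0 // => l; rewrite xiP eq_sym => /negPf ->; rewrite mul0r.
Qed.

(** The [xi i] generate the right module of functionals: by [rhom_eq_omega]
    it suffices to compare values at [omega j], where the claim is that [sh] is
    a right inverse of [sb^T]. *)
Lemma dual_coef_expansion (f : rhom s) :
  mx_alg_hom sb -> bullet (bullet_tr sb) sh =1 @bullet_unit _ _ _ ->
  f = \sum_i rhom_ract (xi i) (dual_coef sh f i).
Proof.
move=> hsb sbsh; apply: (rhom_eq_omega ssb) => j; rewrite rhom_sumE.
transitivity (\sum_i \sum_l sb (sh (f (omega A l)) i l) i j); last first.
  by apply: eq_bigr => i _; rewrite /= dual_scale_omega mx_alg_hom_sum.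
rewrite exchange_big /=.
have collapse l : \sum_i sb (sh (f (omega A l)) i l) i j
    = f (omega A l) *+ (j == l).
  have /matrixP /(_ j l) := sbsh (f (omega A l)); rewrite !mxE => <-.
  by apply: eq_bigr => i _; rewrite mxE.
rewrite (eq_bigr _ (fun l _ => collapse l)) (bigD1 j) //= eqxx mulr1n.
by rewrite big1 ?addr0 // => l; rewrite eq_sym => /negPf ->; rewrite mulr0n.
Qed.

Lemma dual_coef_dual i l : mx_alg_hom sh -> dual_coef sh (xi i) l = (l == i)%:R.
Proof.
move=> hsh; have [_ _ sh1] := hsh.
rewrite /dual_coef (bigD1 i) //= xiP eqxx sh1 mxE.
rewrite big1 ?addr0 // => j; rewrite xiP eq_sym => /negPf ->.
by rewrite mx_alg_hom0 // mxE.
Qed.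

End DualFamily.

Definition dual_nabla dd s sh (xi : 'I_n -> rhom s) (f : rhom s) : A :=
  \sum_i xi i (dd (dual_coef sh f i)).

Lemma dual_nabla_hom_connection dd s sb sh (xi : 'I_n -> rhom s) :
  free_right_twisted_multider dd s sb sh ->
  (forall i j : 'I_n, xi i (omega A j) = (i == j)%:R) ->
  hom_connection dd (dual_nabla dd sh xi).
Proof.
move=> [hdd hsb hsh [_ ssb] [shsb sbsh]] xiP; have [hs ddL _] := hdd.
split=> [c f g | f a].
  rewrite /dual_nabla scaler_sumr -big_split; apply: eq_bigr => i _.
  by rewrite /= dual_coef_linear // ddL rhomD rhom_scalar.
rewrite [X in _ + rhom_fun X _](dual_coef_expansion xiP ssb f hsb sbsh).
rewrite rhom_sumE /dual_nabla mulr_suml -big_split; apply: eq_bigr => i _ /=.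
rewrite (dual_coef_ract _ _ _ hsh ssb shsb) (multider_leibniz _ _ hdd).
by rewrite rhomD rhomM.
Qed.

Lemma dual_nabla_dual dd s sh (xi : 'I_n -> rhom s) i :
  right_twisted_multider dd s -> mx_alg_hom sh ->
  (forall i j : 'I_n, xi i (omega A j) = (i == j)%:R) ->
  dual_nabla dd sh xi (xi i) = 0.
Proof.
move=> hdd hsh xiP; rewrite /dual_nabla big1 // => l _.
rewrite dual_coef_dual //; case: (l == i).
  by rewrite (multider1 hdd) rhom0.
by rewrite (multider0 hdd) rhom0.
Qed.

End HomConnections.

Theorem theorem3p4 (k : fieldType) (A : algType k) (n : nat)
  (partial : A -> 'rV[A]_n) (sigma sigma_bar sigma_hat : A -> 'M[A]_n)
  (Hfree : free_right_twisted_multider partial sigma sigma_bar sigma_hat)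
  (xi : 'I_n -> rhom sigma)
  (Hxi : forall i j : 'I_n, xi i (omega A j) = (i == j)%:R) :
  exists! nabla : rhom sigma -> A,
    hom_connection partial nabla /\ forall i : 'I_n, nabla (xi i) = 0.
Proof.
have [hdd hsb hsh [_ ssb] [_ sbsh]] := Hfree.
exists (dual_nabla partial sigma_hat xi); split.
  split; first exact: dual_nabla_hom_connection Hfree Hxi.
  by move=> i; apply: dual_nabla_dual.
move=> nabla [[nablaL nablaM] nabla_xi]; apply: funext => f.
have nablaD : {morph nabla : g h / g + h}.
  by move=> g h; rewrite -[g in LHS]scale1r nablaL scale1r.
have nabla0 : nabla 0 = 0 by apply: (addrI (nabla 0)); rewrite -nablaD !addr0.
rewrite [in RHS](dual_coef_expansion Hxi ssb f hsb sbsh).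
rewrite (big_morph nabla nablaD nabla0); apply: eq_bigr => i _.
by rewrite nablaM nabla_xi mul0r add0r.
Qed.
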